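(* Let $\mathfrak{X}$ be a complex linear space and let $\mathfrak{t}$ and $\mathfrak{w}$ be forms (nonnegative sesquilinear forms) on $\mathfrak{X}$. Then a $\mathfrak{w}$-Lebesgue decomposition of $\mathfrak{t}$ exists; that is, there exist forms $\mathfrak{t}_r$ and $\mathfrak{t}_s$ on $\mathfrak{X}$ such that $\mathfrak{t}=\mathfrak{t}_r+\mathfrak{t}_s$, where $\mathfrak{t}_r$ is $\mathfrak{w}$-almost dominated and $\mathfrak{t}_s$ is $\mathfrak{w}$-singular.
   Context: A form on the complex linear space $\mathfrak{X}$ is a map $\mathfrak{t}:\mathfrak{X}\times\mathfrak{X}\to\mathbb{C}$ that is linear in its first argument, anti-linear in its second argument, and satisfies $\mathfrak{t}[x]:=\mathfrak{t}(x,x)\ge 0$ for all $x\in\mathfrak{X}$. For forms $\mathfrak{t},\mathfrak{w}$ on $\mathfrak{X}$ write $\mathfrak{t}\le\mathfrak{w}$ if $\mathfrak{t}[x]\le\mathfrak{w}[x]$ for all $x\in\mathfrak{X}$. The form $\mathfrak{t}$ is $\mathfrak{w}$-dominated if there exists $\alpha\ge 0$ such that $\mathfrak{t}\le\alpha\mathfrak{w}$. The form $\mathfrak{t}$ is $\mathfrak{w}$-almost dominated if there is a sequence $(\mathfrak{t}_n)_{n\in\mathbb{N}}$ of $\mathfrak{w}$-dominated forms on $\mathfrak{X}$ which is monotone increasing ($m\le n$ implies $\mathfrak{t}_m\le\mathfrak{t}_n$) and satisfies $\lim_{n\to\infty}\mathfrak{t}_n[x]=\mathfrak{t}[x]$ for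 all $x\in\mathfrak{X}$. The form $\mathfrak{t}$ is $\mathfrak{w}$-singular if for every form $\mathfrak{s}$ on $\mathfrak{X}$, the inequalities $\mathfrak{s}\le\mathfrak{t}$ and $\mathfrak{s}\le\mathfrak{w}$ imply that $\mathfrak{s}$ is the zero form. *)

(* Defs.v *)
From HB Require Import structures.
From mathcomp Require Import all_boot all_order all_algebra.
From mathcomp Require Import complex.
From mathcomp Require Import all_classical all_reals all_analysis.

Set Implicit Arguments.
Unset Strict Implicit.
Unset Printing Implicit Defensive.

Import Order.TTheory GRing.Theory Num.Theory.
Import numFieldNormedType.Exports.

Local Open Scope classical_set_scope.
Local Open Scope complex_scope.
Local Open Scope ring_scope.

(* The order of R[i] is partial: 0 <= z means that z is real and nonnegative. *)
HB.mixin Record isNonnegative (R : realType) (X : lmodType R[i])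
    (t : X -> X -> R[i]) := {
  nnform_ge0 : forall x, 0 <= t x x
}.

#[short(type="nnform")]
HB.structure Definition NonnegativeForm (R : realType) (X : lmodType R[i]) :=
  {t of @Bilinear R[i] X X R[i] *%R (@Num.conj R[i] \; *%R) t
      & isNonnegative R X t}.

Section Forms.
Variables (R : realType) (X : lmodType R[i]).
Implicit Types s t w tr ts : nnform X.

Definition form_le t w := forall x, t x x <= w x x.

Definition dominated w t :=
  exists2 alpha : R, 0 <= alpha & forall x, t x x <= alpha%:C * w x x.

(* R[i]^o (the regular module) carries the topology of the complex modulus;
   R[i] itself has no topological instance. *)
Definition almost_dominated w t :=
  exists t_ : nat -> nnform X,
    [/\ forall n, dominated w (t_ n),
        forall m n, (m <= n)%N -> form_le (t_ m) (t_ n)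
      & forall x, (t_ n x x : R[i]^o) @[n --> \oo] --> (t x x : R[i]^o)].

Definition singular w t :=
  forall s, form_le s t -> form_le s w -> forall x y, s x y = 0.

Definition lebesgue_decomposition w t tr ts :=
  [/\ forall x y, t x y = tr x y + ts x y,
      almost_dominated w tr
    & singular w ts].

End Forms.

(* Main.v *)
(* Let [t : c w] be the parallel sum, [inf_y (t (x - y) + c w y)].  It is
   homogeneous and satisfies the parallelogram law, so it is a form by the
   Jordan-von Neumann theorem; it lies below both [t] and [c w] and increases
   with [c].  The supremum [tr] of the [t : n w] is thus an almost dominated form
   below [t], and every dominated form below [t] lies below [tr].  If
   [s <= t - tr] and [s <= w], then each [s + (t : n w)] is dominated and below
   [t], hence below [tr]; taking the supremum over [n] gives [s + tr <= tr]. *)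

Require Import Defs.
From HB Require Import structures.
From mathcomp Require Import all_boot all_order all_algebra.
From mathcomp Require Import complex ring lra.
From mathcomp Require Import all_classical all_reals all_analysis.

Set Implicit Arguments.
Unset Strict Implicit.
Unset Printing Implicit Defensive.

Import Order.TTheory GRing.Theory Num.Theory.
Import numFieldNormedType.Exports.

Local Open Scope classical_set_scope.
Local Open Scope complex_scope.
Local Open Scope ring_scope.

(** Only the values of the packed form matter later, so the structure is hidden behind an
    existential. *)
Lemma nnform_of_fun (R : realType) (X : lmodType R[i]) (f : X -> X -> R[i])
    (fDl : forall x x' y, f (x + x') y = f x y + f x' y)
    (fZl : forall a x y, f (a *: x) y = a * f x y)
    (fDr : forall x y y', f x (y + y') = f x y + f x y')
    (fZr : forall a x y, f x (a *: y) = a^*%C * f x y)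
    (f_ge0 : forall x, 0 <= f x x) :
  exists t : nnform X, forall x y, t x y = f x y.
Proof.
have fB : bilinear_for *%R (@Num.conj R[i] \; *%R) f.
  split=> [y a x x'|x a y y'] /=; first by rewrite fDl fZl.
  by rewrite fDr fZr.
pose HB1 := bilinear_isBilinear.Build R[i] X X R[i]
  *%R (@Num.conj R[i] \; *%R) f fB.
pose HB2 := isNonnegative.Build R X f f_ge0.
pose t : nnform X := HB.pack f HB1 HB2.
by exists t.
Qed.

(** * Quadratic forms and polarization *)

Section FormTheory.
Variables (R : realType) (X : lmodType R[i]).
Implicit Types (s t w : nnform X) (x y : X).

(** Taking values in [R] puts all estimates in a totally ordered field; nothing is lost, since
    [t x x] is real. *)
Definition qf t x : R := complex.Re (t x x).

Lemma qfE t x : t x x = (qf t x)%:C.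
Proof.
rewrite /qf; have := nnform_ge0 (s := t) x.
by rewrite lecE => /andP[/eqP /=]; case: (t x x) => a b /= ->.
Qed.

Lemma formDl t x x' y : t (x + x') y = t x y + t x' y.
Proof. exact: linearDl. Qed.

Lemma formDr t x y y' : t x (y + y') = t x y + t x y'.
Proof. exact: linearDr. Qed.

Lemma formZl t a x y : t (a *: x) y = a * t x y.
Proof. exact: linearZl. Qed.

Lemma formZr t a x y : t x (a *: y) = a^*%C * t x y.
Proof. exact: linearZr. Qed.

Lemma formNl t x y : t (- x) y = - t x y.
Proof. exact: linearNl. Qed.

Lemma formNr t x y : t x (- y) = - t x y.
Proof. exact: linearNr. Qed.

Lemma qf_ge0 t x : 0 <= qf t x.
Proof. by rewrite -lecR -qfE; apply: nnform_ge0. Qed.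

Lemma form_leE s t : form_le s t <-> forall x, qf s x <= qf t x.
Proof. by split=> le_st x; have := le_st x; rewrite !qfE lecR. Qed.

Lemma qfZ t a x :
  qf t (a *: x) = (complex.Re a ^+ 2 + complex.Im a ^+ 2) * qf t x.
Proof.
rewrite {1}/qf formZl formZr qfE.
by case: a => a b /=; ring.
Qed.

Lemma qf_parallelogram t x y :
  qf t (x + y) + qf t (x - y) = 2 * (qf t x + qf t y).
Proof.
rewrite /qf !(formDl, formDr, formNl, formNr); case: (t x x) => ? ?.
by case: (t x y) => ? ?; case: (t y x) => ? ?; case: (t y y) => ? ? /=; ring.
Qed.

(** Polarization: expanding [t (x + z) (x + z)] gives [t x z + t z x = 0]. With [z = y] and
    [z = 'i y], [t x y] is both opposite and equal to [t y x]. *)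
Lemma form_eq0 t : (forall x, qf t x = 0) -> forall x y, t x y = 0.
Proof.
move=> t0 x y; have tD z : t x z + t z x = 0.
  have := qfE t (x + z); rewrite !(formDl, formDr) !qfE !t0.
  by rewrite !add0r addr0 addrC.
have := tD ('i%C *: y); rewrite formZl formZr.
have := tD y; case: (t x y) => a b; case: (t y x) => c d.
case=> h1 h2 [h3 h4]; apply/eqP; rewrite eq_complex /=.
by apply/andP; split; apply/eqP; lra.
Qed.

(* The square [t (e x - y) >= 0] bounds the mixed terms, up to the factor [e]. *)
Lemma qf_peter_paul t (e : R) x y : 0 < e ->
  qf t (x + y) <= (1 + e) * qf t x + (1 + e^-1) * qf t y.
Proof.
move=> e_gt0; have := qf_ge0 t (e%:C *: x - y).
have -> : qf t (e%:C *: x - y) =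
    e * ((1 + e) * qf t x + (1 + e^-1) * qf t y - qf t (x + y)).
  rewrite /qf !(formDl, formDr, formNl, formNr, formZl, formZr).
  case: (t x x) => ? ?; case: (t x y) => ? ?.
  case: (t y x) => ? ?; case: (t y y) => ? ? /=; field.
  by rewrite gt_eqF.
by rewrite pmulr_rge0 // subr_ge0.
Qed.

End FormTheory.

(** * The Jordan-von Neumann theorem *)

Section JordanVonNeumann.
Variables (R : realType) (X : lmodType R[i]) (q : X -> R).
Hypothesis q_ge0 : forall x, 0 <= q x.
(** Inequalities are what infima and suprema supply directly; [qZ] and [q_parallelogram] upgrade
    them to equalities. *)
Hypothesis qZ_le : forall a x,
  q (a *: x) <= (complex.Re a ^+ 2 + complex.Im a ^+ 2) * q x.
Hypothesis q_parallelogram_le : forall x y,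
  q (x + y) + q (x - y) <= 2 * (q x + q y).

Let q0 : q 0 = 0.
Proof.
apply/eqP; rewrite eq_le q_ge0 andbT.
by have := qZ_le 0 0; rewrite scale0r /= expr0n /= addr0 mul0r.
Qed.

(** For [a != 0], the converse is the hypothesis at [a^-1] and [a *: x]. *)
Let qZ a x : q (a *: x) = (complex.Re a ^+ 2 + complex.Im a ^+ 2) * q x.
Proof.
have [->|a_neq0] := eqVneq a 0.
  by rewrite scale0r q0 /= expr0n /= addr0 mul0r.
apply/eqP; rewrite eq_le qZ_le /=.
have := qZ_le a^-1 (a *: x); rewrite scalerA mulVf // scale1r => h.
have n_gt0 : 0 < complex.Re a ^+ 2 + complex.Im a ^+ 2.
  rewrite lt_def addr_ge0 ?sqr_ge0 // andbT; apply: contra a_neq0.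
  by case: a {h} => a b /=; rewrite paddr_eq0 ?sqr_ge0 // !sqrf_eq0 eq_complex.
rewrite -ler_pdivlMl //; apply: le_trans h _.
rewrite ler_wpM2r //.
case: a a_neq0 n_gt0 => a b _ /= n_gt0.
rewrite le_eqVlt; apply/orP; left; apply/eqP; field.
by rewrite gt_eqF.
Qed.

Let qN x : q (- x) = q x.
Proof. by rewrite -scaleN1r qZ /= oppr0 expr0n /= addr0 sqrrN expr1n mul1r. Qed.

(** The converse is the hypothesis at [x + y] and [x - y], whose sum and difference are [2 x] and
    [2 y]. *)
Let q_parallelogram x y : q (x + y) + q (x - y) = 2 * (q x + q y).
Proof.
apply/eqP; rewrite eq_le q_parallelogram_le /=.
have := q_parallelogram_le (x + y) (x - y).
have -> : x + y + (x - y) = 2 *: x.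
  by rewrite addrACA subrr addr0 scaler_nat mulr2n.
have -> : x + y - (x - y) = 2 *: y.
  by rewrite opprB addrC addrA subrK scaler_nat mulr2n.
rewrite !qZ /= !addr0; lra.
Qed.

(** The real part of the form to be built. *)
Let b x y : R := (q (x + y) - q (x - y)) / 4.

Let bC x y : b x y = b y x.
Proof. by rewrite /b (addrC x) -[q (x - y)]qN opprB. Qed.

(** Subtracting the parallelogram laws at [(u + y, v)] and [(u - y, v)] gives [P]. Adding [P x x']
    and [P x' x] cancels the differences, because [b] is odd. *)
Let bDl x x' y : b (x + x') y = b x y + b x' y.
Proof.
have P u v : b (u + v) y + b (u - v) y = 2 * b u y.
  have := q_parallelogram (u + y) v; have := q_parallelogram (u - y) v.
  rewrite /b (addrAC u v) (addrAC u (- v)) (addrAC u y) (addrAC u (- y)).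
  by rewrite (addrAC u (- y)) (addrAC u y); lra.
have bNl u : b (- u) y = - b u y.
  by rewrite /b -opprD qN -[q (- u + y)]qN opprD opprK; lra.
have := P x x'; have := P x' x.
by rewrite -[x' - x]opprB bNl [x' + x]addrC; lra.
Qed.

(* [r |-> b (r x) y - r b x y] is additive, vanishes at 1 and is bounded on
   [0, 1]; being 1-periodic it is bounded everywhere, hence zero. *)
Let bZl (r : R) x y : b (r%:C *: x) y = r * b x y.
Proof.
pose g s := b (s%:C *: x) y - s * b x y.
have gD s s' : g (s + s') = g s + g s'.
  by rewrite /g rmorphD scalerDl bDl; lra.
have g1 : g 1 = 0 by rewrite /g scale1r; lra.
have g0 : g 0 = 0 by have := gD 0 0; rewrite addr0; lra.
have gN s : g (- s) = - g s by have := gD s (- s); rewrite subrr g0; lra.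
have gM n s : g (n%:R * s) = n%:R * g s.
  elim: n => [|n IHn]; first by rewrite !mul0r g0.
  by rewrite -natr1 mulrDl mul1r gD IHn; lra.
have gZ (m : int) : g m%:~R = 0.
  case: m => n; first by rewrite -pmulrn -[n%:R]mulr1 gM g1 mulr0.
  by rewrite NegzE mulrNz gN -pmulrn -[n.+1%:R]mulr1 gM g1 mulr0 oppr0.
pose K := q x + q y + `|b x y|.
have g_le s : `|g s| <= K.
  have -> : g s = g (s - (Num.floor s)%:~R) by rewrite gD gN gZ subr0.
  have := floor_itv s; set u := s - _ => /andP[].
  rewrite intrD1 => fl fu.
  have u0 : 0 <= u by rewrite subr_ge0.
  have u1 : u <= 1 by rewrite lerBlDl ltW.
  rewrite /g; apply: le_trans (ler_normB _ _) _.
  apply: lerD; last by rewrite normrM ger0_norm // ler_piMl.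
  have := q_parallelogram (u%:C *: x) y; rewrite qZ /= expr0n /= addr0.
  have := q_ge0 (u%:C *: x + y); have := q_ge0 (u%:C *: x - y).
  have := q_ge0 x; have := q_ge0 y => ? ? ? ? ?.
  have ? : u ^+ 2 * q x <= q x by rewrite ler_piMl // expr_le1.
  by rewrite /b ler_norml; apply/andP; split; lra.
suff g_eq0 : g r = 0 by move: g_eq0; rewrite /g; lra.
apply/eqP; case: eqVneq => // gr_neq0.
have gr_gt0 : 0 < `|g r| by rewrite normr_gt0.
(* An integer [n > K / |g r|] would make [|g (n r)| = n |g r|] exceed [K]. *)
have := archi_boundP (divr_ge0 (le_trans (normr_ge0 _) (g_le r)) (ltW gr_gt0)).
rewrite ltr_pdivrMr // ltNge => /negP[].
by rewrite -[X in X * _]normr_nat -normrM -gM.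
Qed.

(** Invariance of [q] under ['i] makes multiplication by ['i] skew for [b], the source of complex
    sesquilinearity. *)
Let bil x y : b ('i%C *: x) ('i%C *: y) = b x y.
Proof.
by rewrite /b -scalerBr -scalerDr !qZ /= expr0n /= add0r expr1n !mul1r.
Qed.

Lemma jordan_von_neumann : exists t : nnform X, forall x, qf t x = q x.
Proof.
(* Antilinearity in [y] forces the imaginary part at [y] to be the real part at ['i y]. *)
pose f x y := b x y +i* b x ('i%C *: y).
have bDr x y y' : b x (y + y') = b x y + b x y'.
  by rewrite bC bDl !(bC x).
have bZr (r : R) x y : b x (r%:C *: y) = r * b x y by rewrite bC bZl bC.
have bNr x y : b x (- y) = - b x y.
  by have := bZr (- 1) x y; rewrite rmorphN1 scaleN1r mulN1r.
have iiN (y : X) : 'i%C *: ('i%C *: y) = - y.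
  by rewrite scalerA -expr2 sqr_i scaleN1r.
have b_i x y : b ('i%C *: x) y = - b x ('i%C *: y).
  by rewrite -[in RHS]bil iiN bNr opprK.
have Zsplit (a : R[i]) (x : X) :
    a *: x = (complex.Re a)%:C *: x + (complex.Im a)%:C *: ('i%C *: x).
  by rewrite scalerA -scalerDl {1}[a]complexE [in LHS]mulrC.
have Zi (a : R[i]) (x : X) : 'i%C *: (a *: x) = a *: ('i%C *: x).
  by rewrite !scalerA mulrC.
have [t tE] : exists t : nnform X, forall x y, t x y = f x y.
  apply: nnform_of_fun.
  - by move=> x x' y; rewrite /f !bDl.
  - move=> a x y; rewrite /f [a *: x]Zsplit !bDl !bZl !b_i iiN bNr.
    by case: a => a c; apply/eqP; rewrite eq_complex /=; apply/andP; split;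
      apply/eqP; ring.
  - by move=> x y y'; rewrite /f scalerDr !bDr.
  - move=> a x y; rewrite /f Zi ![a *: _]Zsplit !bDr !bZr iiN !bNr.
    by case: a => a c; apply/eqP; rewrite eq_complex /=; apply/andP; split;
      apply/eqP; ring.
  - move=> x; rewrite /f lecE /=.
    (* By symmetry and skewness, [b x ('i x)] is its own opposite. *)
    have bxix : b x ('i%C *: x) = 0 by have := b_i x x; rewrite bC; lra.
    by rewrite bxix eqxx /= /b subrr q0 subr0 divr_ge0.
exists t => x; rewrite /qf tE /= /b subrr q0 subr0.
have -> : x + x = 2 *: x by rewrite scaler_nat mulr2n.
by rewrite qZ /= addr0; field.
Qed.

End JordanVonNeumann.

(** * The parallel sum and its extremal property *)

Section ParallelSum.
Variables (R : realType) (X : lmodType R[i]) (t w : nnform X).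
Implicit Types (c : R) (x y : X).

Definition parallel_sum c x : R :=
  inf (range (fun y => qf t (x - y) + c * qf w y)).

Lemma parallel_sum_ge c x m :
  (forall y, m <= qf t (x - y) + c * qf w y) -> m <= parallel_sum c x.
Proof.
move=> m_le; apply: lb_le_inf; first by exists (qf t (x - 0) + c * qf w 0), 0.
by move=> _ [y _ <-].
Qed.

Lemma parallel_sum_le c x y : 0 <= c ->
  parallel_sum c x <= qf t (x - y) + c * qf w y.
Proof.
move=> c_ge0; apply: ge_inf; last by exists y.
by exists 0 => _ [z _ <-]; rewrite addr_ge0 ?mulr_ge0 ?qf_ge0.
Qed.

Lemma parallel_sum_le_left c x : 0 <= c -> parallel_sum c x <= qf t x.
Proof.
move=> /(parallel_sum_le x 0) /le_trans; apply.
by rewrite /(qf w) linear0l mulr0 addr0 subr0.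
Qed.

Lemma parallel_sum_le_right c x : 0 <= c -> parallel_sum c x <= c * qf w x.
Proof.
move=> /(parallel_sum_le x x) /le_trans; apply.
by rewrite subrr /(qf t) linear0l add0r.
Qed.

Lemma parallel_sum_mono c c' x : 0 <= c -> c <= c' ->
  parallel_sum c x <= parallel_sum c' x.
Proof.
move=> c_ge0 le_cc'; apply: parallel_sum_ge => y.
apply: le_trans (parallel_sum_le x y c_ge0) _.
by rewrite lerD2l ler_wpM2r ?qf_ge0.
Qed.

Lemma parallel_sum_form c : 0 <= c ->
  exists p : nnform X, forall x, qf p x = parallel_sum c x.
Proof.
move=> c_ge0; apply: jordan_von_neumann.
- move=> x; apply: parallel_sum_ge => y.
  by rewrite addr_ge0 ?mulr_ge0 ?qf_ge0.
- move=> a x; set k := _ + _.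
  have k_ge0 : 0 <= k by rewrite addr_ge0 ?sqr_ge0.
  (* Each [y] competing for [x] yields the competitor [a *: y] for [a *: x]. *)
  have le_k y :
      parallel_sum c (a *: x) <= k * (qf t (x - y) + c * qf w y).
    apply: le_trans (parallel_sum_le _ (a *: y) c_ge0) _.
    by rewrite -scalerBr !qfZ -/k mulrDr [c * (k * _)]mulrCA.
  move: k_ge0; rewrite le_eqVlt => /orP[/eqP k0|k_gt0].
    by have := le_k 0; rewrite -k0 !mul0r.
  rewrite -ler_pdivrMl //; apply: parallel_sum_ge => y.
  by rewrite ler_pdivrMl //; apply: le_k.
(* The competitors [y + y'] and [y - y'] are used for [x + x'] and [x - x']; the infima over [y] and
   [y'] are taken in turn. *)
- move=> x x'; set s := _ + _.
  suff : s / 2 - parallel_sum c x' <= parallel_sum c x by lra.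
  apply: parallel_sum_ge => y.
  suff : s / 2 - (qf t (x - y) + c * qf w y) <= parallel_sum c x' by lra.
  apply: parallel_sum_ge => y'.
  have := parallel_sum_le (x + x') (y + y') c_ge0.
  have := parallel_sum_le (x - x') (y - y') c_ge0.
  have := qf_parallelogram t (x - y) (x' - y').
  have := congr1 ( *%R c) (qf_parallelogram w y y').
  rewrite (_ : x - y + (x' - y') = x + x' - (y + y')); last first.
    by rewrite addrACA -opprD.
  rewrite (_ : x - y - (x' - y') = x - x' - (y - y')); last first.
    rewrite [- (x' - y')]opprB [y' - x']addrC addrACA.
    by rewrite [- (y - y')]opprB [y' - y]addrC.
  by rewrite /s !mulrDr; lra.
Qed.

(* With [u <= t] and [u <= alpha w], splitting [x = (x - y) + y] gives
   [u x <= (1 + e) (t (x - y) + (alpha / e) w y)] for every [e > 0]. *)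
Lemma dominated_form_le (u : nnform X) (alpha : R) x m :
  0 <= alpha -> (forall y, qf u y <= qf t y) ->
  (forall y, qf u y <= alpha * qf w y) ->
  (forall n : nat, parallel_sum n%:R x <= m) -> qf u x <= m.
Proof.
move=> alpha_ge0 le_ut le_uw le_m.
have m_ge0 : 0 <= m.
  apply: le_trans (le_m 0); apply: parallel_sum_ge => y.
  by rewrite addr_ge0 ?mulr_ge0 ?qf_ge0.
have le_e e : 0 < e -> qf u x <= (1 + e) * m.
  move=> e_gt0; have e1_gt0 : 0 < 1 + e by rewrite addr_gt0.
  (* Some integer [n >= alpha / e] serves as the parameter. *)
  have /ltW := archi_boundP (divr_ge0 alpha_ge0 (ltW e_gt0)).
  set n := Num.bound _ => alpha_le.
  apply: le_trans (ler_wpM2l (ltW e1_gt0) (le_m n)).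
  rewrite -ler_pdivrMl //; apply: parallel_sum_ge => y.
  rewrite ler_pdivrMl // -{1}[x](subrK y).
  apply: le_trans (qf_peter_paul u (x - y) y e_gt0) _.
  rewrite mulrDr lerD ?ler_pM2l //.
  rewrite (_ : 1 + e^-1 = (1 + e) / e); last by field; rewrite gt_eqF.
  rewrite -mulrA ler_pM2l // ler_pdivrMl //.
  apply: le_trans (le_uw y) _.
  by rewrite mulrA ler_wpM2r ?qf_ge0 // mulrC -ler_pdivrMr.
(* Since [m] may vanish, [e] is rescaled by [m + 1]; the excess [e m / (m + 1)] is at most [e]. *)
apply/ler_addgt0Pr => e e_gt0.
have M_gt0 : 0 < m + 1 by rewrite ltr_wpDl.
apply: le_trans (le_e (e / (m + 1)) (divr_gt0 e_gt0 M_gt0)) _.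
rewrite mulrDl mul1r lerD2l mulrAC ler_pdivrMr //.
by rewrite ler_pM2l // lerDl.
Qed.

End ParallelSum.

(** * Convergence and the Lebesgue decomposition *)

Lemma cvg_form (R : realType) (X : lmodType R[i]) (t_ : nat -> nnform X)
    (t : nnform X) x :
  qf (t_ n) x @[n --> \oo] --> qf t x ->
  (t_ n x x : R[i]^o) @[n --> \oo] --> (t x x : R[i]^o).
Proof.
move=> /cvgrPdist_lt qcvg; apply/cvgrPdist_lt => e.
(* A radius positive in [R[i]] is real, so the real limit can be tested at its real part. *)
rewrite ltcE /= => /andP[/eqP e_real e_gt0].
have := qcvg _ e_gt0; apply: filterS => n.
rewrite !qfE -rmorphB normc_def /= expr0n /= addr0 sqrtr_sqr.
by rewrite ltcE /= e_real eqxx.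
Qed.

Theorem theorem3p1 (R : realType) (X : lmodType R[i]) (t w : nnform X) :
  exists tr ts : nnform X, lebesgue_decomposition w t tr ts.
Proof.
have /choice[t_ t_E] : forall n : nat, exists p : nnform X,
    forall x, qf p x = parallel_sum t w n%:R x.
  by move=> n; apply: parallel_sum_form.
have t_mono x : nondecreasing_seq (fun n => qf (t_ n) x).
  by move=> m n le_mn; rewrite !t_E parallel_sum_mono ?ler_nat.
have t_le n x : qf (t_ n) x <= qf t x.
  by rewrite t_E parallel_sum_le_left.
pose r x := sup (range (fun n => qf (t_ n) x)).
have t_bounded x : has_ubound (range (fun n => qf (t_ n) x)).
  by exists (qf t x) => _ [n _ <-].
have le_r n x : qf (t_ n) x <= r x.
  by apply: ub_le_sup => //; exists n.
have r_le x m : (forall n, qf (t_ n) x <= m) -> r x <= m.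
  move=> le_m; apply: ge_sup; first by exists (qf (t_ 0) x), 0.
  by move=> _ [n _ <-].
have t_cvg x : qf (t_ n) x @[n --> \oo] --> r x.
  exact: nondecreasing_cvgn.
have [tr trE] : exists tr : nnform X, forall x, qf tr x = r x.
  apply: jordan_von_neumann.
  - by move=> x; apply: le_trans (le_r 0 x); apply: qf_ge0.
  - move=> a x; apply: r_le => n; rewrite qfZ ler_wpM2l //.
    by rewrite addr_ge0 ?sqr_ge0.
  (* By monotonicity the suprema are limits, and limits respect sums. *)
  - move=> x y; rewrite mulr_natl.
    have lhs_cvg : qf (t_ n) (x + y) + qf (t_ n) (x - y) @[n --> \oo]
        --> r (x + y) + r (x - y) by exact: cvgD.
    have rhs_cvg : (qf (t_ n) x + qf (t_ n) y) *+ 2 @[n --> \oo]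
        --> (r x + r y) *+ 2 by apply: cvgMn; exact: cvgD.
    apply: ler_cvg_to lhs_cvg rhs_cvg _.
    by apply: nearW => n; rewrite qf_parallelogram mulr_natl.
have [ts tsE] : exists ts : nnform X, forall x y, ts x y = t x y - tr x y.
  apply: nnform_of_fun => [x x' y|a x y|x y y'|a x y|x].
  - by rewrite !formDl opprD addrACA.
  - by rewrite !formZl mulrBr.
  - by rewrite !formDr opprD addrACA.
  - by rewrite !formZr mulrBr.
  - by rewrite !qfE subr_ge0 lecR trE r_le.
exists tr, ts; split.
- by move=> x y; rewrite tsE addrC subrK.
- exists t_; split.
  + move=> n; exists n%:R => // x.
    by rewrite !qfE -rmorphM lecR t_E parallel_sum_le_right.
  + by move=> m n le_mn; apply/form_leE => x; apply: t_mono.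
  + by move=> x; apply: cvg_form; rewrite trE.
move=> s /form_leE s_ts /form_leE s_w.
have s_le x : qf s x <= qf t x - r x.
  by apply: le_trans (s_ts x) _; rewrite -trE /qf tsE raddfB.
apply: form_eq0 => x; apply/eqP; rewrite eq_le qf_ge0 andbT.
(* By the supremum over [n], it is enough that [s + t_ n] lies below [r] for each [n]. *)
suff : r x <= r x - qf s x by lra.
apply: r_le => n.
have [u uE] : exists u : nnform X, forall x y, u x y = s x y + t_ n x y.
  apply: nnform_of_fun => [z z' y|a z y|z y y'|a z y|z].
  - by rewrite !formDl addrACA.
  - by rewrite !formZl mulrDr.
  - by rewrite !formDr addrACA.
  - by rewrite !formZr mulrDr.
  - by rewrite addr_ge0 ?nnform_ge0.
have quE z : qf u z = qf s z + qf (t_ n) z by rewrite /qf uE raddfD.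
suff : qf u x <= r x by rewrite quE; lra.
(* The constant adds [s <= w] to [t_ n <= n w]; [u <= t] follows from [s <= t - r] and
   [t_ n <= r]. *)
apply: (dominated_form_le (t := t) (w := w) (alpha := 1 + n%:R)).
- by rewrite addr_ge0.
- by move=> z; rewrite quE; have := s_le z; have := le_r n z; lra.
- move=> z; rewrite quE mulrDl mul1r lerD //.
  by rewrite t_E parallel_sum_le_right.
- by move=> k; rewrite -t_E.
Qed.
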